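(* Let $R$ be a commutative refinement ring and let $M$ and $N$ be finitely generated projective $R$-modules. Then $M\cong N$ if and only if $M_P\cong N_P$ for every maximal ideal $P$ of $R$.
   Context: A ring $R$ is a refinement ring if the monoid $V(R)$ of isomorphism classes of finitely generated projective $R$-modules (under direct sum) has the refinement property: whenever $x_1+x_2=y_1+y_2$ in $V(R)$, there exist $z_{ij}\in V(R)$ with $x_i=z_{i1}+z_{i2}$ and $y_j=z_{1j}+z_{2j}$. $M_P=M\otimes_R R_P$ denotes localization at $P$. *)

(* Defs.v *)
From mathcomp Require Import all_boot all_algebra.
Set Implicit Arguments. Unset Strict Implicit. Unset Printing Implicit Defensive.
Import GRing.Theory.
Local Open Scope ring_scope.

Definition mod_iso (R : pzRingType) (M N : lmodType R) : Prop :=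
  exists f : M -> N, linear f /\ bijective f.

Definition fg_projective (R : pzRingType) (M : lmodType R) : Prop :=
  exists (n : nat) (p : 'rV[R]_n -> M) (i : M -> 'rV[R]_n),
    linear p /\ linear i /\ cancel i p.

(* Refinement property of the monoid V(R) of iso classes of f.g. projective
   R-modules under direct sum. *)
Definition refinement_ring (R : pzRingType) : Prop :=
  forall X1 X2 Y1 Y2 : lmodType R,
    fg_projective X1 -> fg_projective X2 ->
    fg_projective Y1 -> fg_projective Y2 ->
    mod_iso (X1 * X2)%type (Y1 * Y2)%type ->
    exists Z11 Z12 Z21 Z22 : lmodType R,
      [/\ fg_projective Z11, fg_projective Z12,
          fg_projective Z21 & fg_projective Z22] /\
      [/\ mod_iso X1 (Z11 * Z12)%type, mod_iso X2 (Z21 * Z22)%type,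
          mod_iso Y1 (Z11 * Z21)%type & mod_iso Y2 (Z12 * Z22)%type].

Definition is_ideal (R : comPzRingType) (I : R -> Prop) : Prop :=
  [/\ I 0, (forall x y, I x -> I y -> I (x + y)) &
      (forall r x, I x -> I (r * x))].

Definition maximal_ideal (R : comPzRingType) (P : R -> Prop) : Prop :=
  [/\ is_ideal P, ~ P 1 &
      forall I : R -> Prop, is_ideal I -> (forall x, P x -> I x) -> ~ I 1 ->
        forall x, I x -> P x].

(* Localization M_P = M (x) R_P, presented by fractions m/s (s not in P):
   a fraction is a pair (m, s) with ~ P s, and
   m/s = m'/s'  iff  u (s' m - s m') = 0 for some u not in P. *)
Section Loc.
Variables (R : comPzRingType) (P : R -> Prop) (M : lmodType R).

Definition loc_eq (x y : M * R) : Prop :=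
  exists u : R, ~ P u /\ u *: (y.2 *: x.1 - x.2 *: y.1) = 0.

Definition loc_add (x y : M * R) : M * R :=
  (y.2 *: x.1 + x.2 *: y.1, x.2 * y.2).

(* (r/t) . (m/s) = (r m) / (t s) : the R_P-module action *)
Definition loc_scale (r t : R) (x : M * R) : M * R :=
  (r *: x.1, t * x.2).
End Loc.

(* M_P ~= N_P as R_P-modules: an R_P-linear bijection between the
   fraction modules, given on representatives. *)
Definition loc_iso (R : comPzRingType) (P : R -> Prop) (M N : lmodType R)
  : Prop :=
  exists (f : M * R -> N * R) (g : N * R -> M * R),
    [/\ (forall x, ~ P x.2 -> ~ P (f x).2),
        (forall y, ~ P y.2 -> ~ P (g y).2),
        (forall x y, ~ P x.2 -> ~ P y.2 -> loc_eq P x y -> loc_eq P (f x) (f y)),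
        (forall x y, ~ P x.2 -> ~ P y.2 -> loc_eq P x y -> loc_eq P (g x) (g y))
      & [/\ (forall x y, ~ P x.2 -> ~ P y.2 ->
               loc_eq P (f (loc_add x y)) (loc_add (f x) (f y))),
            (forall r t x, ~ P t -> ~ P x.2 ->
               loc_eq P (f (loc_scale r t x)) (loc_scale r t (f x))),
            (forall x, ~ P x.2 -> loc_eq P (g (f x)) x)
          & (forall y, ~ P y.2 -> loc_eq P (f (g y)) y)]].

(* Main.v *)
(* Applying refinement to [M (+) K ~= R (+) ... (+) R] splits every f.g.
   projective module [M] as a direct sum of ideals [e_j R], [e_j] idempotent.
   At a maximal ideal [P] the rank of such a sum is the number of [e_j] not in
   [P], so [M_P ~= N_P] forces [M] and [N] to have the same number of those.  A
   product of idempotents [e_j], [1 - e_j] is then an idempotent [a] not in [P]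
   for which [aM] and [aN] are isomorphic.  The idempotents with that last
   property generate an ideal contained in no maximal ideal, and they are
   closed under orthogonal sums, so [1] is one of them. *)
Require Import Defs.
From HB Require Import structures.
From mathcomp Require Import all_boot all_algebra.
From mathcomp Require Import boolp classical_sets.
From mathcomp Require Import ring.
Set Implicit Arguments. Unset Strict Implicit. Unset Printing Implicit Defensive.
Import GRing.Theory.
Local Open Scope ring_scope.

(** * Linear isomorphisms and kernels *)

Lemma linear_bundle (R : pzRingType) (U V : lmodType R) (f : U -> V) :
  linear f -> exists F : {linear U -> V}, F =1 f.
Proof.
move=> lf.
pose F : {linear U -> V} := HB.pack f (GRing.isLinear.Build R U V *:%R f lf).
by exists F.
Qed.

Lemma can_linear (R : pzRingType) (U V : lmodType R) (f : {linear U -> V})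
    (g : V -> U) :
  cancel f g -> cancel g f -> linear g.
Proof. by move=> fK gK a u v; rewrite -{1}(gK u) -{1}(gK v) -linearP fK. Qed.

Lemma mod_iso_bundle (R : pzRingType) (U V : lmodType R) :
  mod_iso U V ->
  exists (f : {linear U -> V}) (g : {linear V -> U}), cancel f g /\ cancel g f.
Proof.
move=> [f0 [/linear_bundle[f fE] [g fK gK]]].
have gfK : cancel f g by move=> x; rewrite fE fK.
have fgK : cancel g f by move=> x; rewrite fE gK.
have [g' g'E] := linear_bundle (can_linear gfK fgK).
by exists f, g'; split=> x; rewrite g'E.
Qed.

Section LinearKernel.
Variables (R : pzRingType) (U V : lmodType R) (f : {linear U -> V}).

Definition in_ker : {pred U} := fun u => f u == 0.

Lemma in_kerE u : (u \in in_ker) = (f u == 0).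
Proof. by []. Qed.

Fact in_ker_submod : subsemimod_closed in_ker.
Proof.
split; [split|]; first by rewrite in_kerE linear0.
- by move=> u v; rewrite !in_kerE linearD => /eqP-> /eqP->; rewrite addr0.
- by move=> a u; rewrite !in_kerE linearZ => /eqP->; rewrite /= scaler0.
Qed.

HB.instance Definition _ := GRing.isSubmodClosed.Build R U in_ker in_ker_submod.

(** The kernel as a module in its own right, so that it can serve as a direct complement. *)
Record ker_mod := KerMod { ker_val :> U; _ : ker_val \in in_ker }.
HB.instance Definition _ := [isSub for ker_val].
HB.instance Definition _ := [Choice of ker_mod by <:].
HB.instance Definition _ := [SubChoice_isSubLmodule of ker_mod by <:].

End LinearKernel.

(** * Splitting projective modules into ideals generated by idempotents *)

Definition diag_act (R : pzRingType) n (e v : 'rV[R]_n) : 'rV[R]_n :=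
  \row_j (v 0 j * e 0 j).

(* [M] is isomorphic to the direct sum of the ideals [e_j R]: it is a retract
   of [R^n] whose associated idempotent matrix is [diag(e)]. *)
Definition diag_pres (R : pzRingType) (M : lmodType R) n (e : 'rV[R]_n) : Prop :=
  exists (p : {linear 'rV[R]_n -> M}) (i : {linear M -> 'rV[R]_n}),
    cancel i p /\ forall v, i (p v) = diag_act e v.

Lemma fg_projective_bundle (R : pzRingType) (M : lmodType R) :
  fg_projective M ->
  exists n (p : {linear 'rV[R]_n -> M}) (i : {linear M -> 'rV[R]_n}), cancel i p.
Proof.
move=> [n [p0 [i0 [/linear_bundle[p pE] [/linear_bundle[i iE] ipK]]]]].
by exists n, p, i => x; rewrite pE iE.
Qed.

(** The complement is the kernel of the retraction [p], onto which [v - i (p v)] projects. *)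
Lemma fg_projective_complement (R : pzRingType) (M : lmodType R) :
  fg_projective M ->
  exists n (K : lmodType R), fg_projective K /\ mod_iso (M * K)%type 'rV[R]_n.
Proof.
move=> /fg_projective_bundle[n [p [i ipK]]].
have kerq v : v - i (p v) \in in_ker p by rewrite in_kerE linearB ipK subrr.
pose q v : ker_mod p := KerMod (kerq v).
have qlin : linear q.
  move=> a u v; apply: val_inj.
  by rewrite /= !linearP /= addrACA -scalerDr.
have pval (k : ker_mod p) : p (val k) = 0 by apply/eqP; exact: (valP k).
exists n, (ker_mod p); split.
  exists n, q, val; split=> //; split; first by move=> a u v; rewrite linearP.
  by move=> k; apply: val_inj; rewrite /= pval linear0 subr0.
exists (fun x => i x.1 + val x.2); split.
  by move=> a x y; rewrite /= !linearP /= scalerDr addrACA.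
exists (fun v => (p v, q v)) => [[x k]|v] /=; last by rewrite addrC subrK.
have pE : p (i x + val k) = x by rewrite linearD ipK pval addr0.
by congr pair => //; apply: val_inj; rewrite /= pE addrAC subrr add0r.
Qed.

Lemma fg_projective_rV (R : pzRingType) n : fg_projective 'rV[R]_n.
Proof. by exists n, id, id; split=> // a u v. Qed.

Lemma mod_iso_pair_rV (R : pzRingType) m n :
  mod_iso 'rV[R]_(m + n) ('rV[R]_m * 'rV[R]_n)%type.
Proof.
exists (fun v => (lsubmx v, rsubmx v)); split.
  by move=> a u v; rewrite !linearP.
exists (fun x => row_mx x.1 x.2) => [v|[u v]] /=; first by rewrite hsubmxK.
by rewrite row_mxKl row_mxKr.
Qed.

Lemma mod_iso_trans (R : pzRingType) (U V W : lmodType R) :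
  mod_iso U V -> mod_iso V W -> mod_iso U W.
Proof.
move=> [f [lf bf]] [g [lg bg]]; exists (g \o f); split; last exact: bij_comp.
by move=> a u v; rewrite /= lf lg.
Qed.

Lemma mod_iso_sym (R : pzRingType) (U V : lmodType R) :
  mod_iso U V -> mod_iso V U.
Proof.
move=> /mod_iso_bundle[f [g [fK gK]]]; exists g; split; first exact: linearP.
by exists f.
Qed.

Lemma diag_pres_iso (R : pzRingType) (M N : lmodType R) n (e : 'rV[R]_n) :
  mod_iso M N -> diag_pres N e -> diag_pres M e.
Proof.
move=> /mod_iso_bundle[f [g [fK gK]]] [p [i [ipK piE]]].
exists (g \o p)%FUN, (i \o f)%FUN; split=> [x|v] /=; first by rewrite ipK fK.
by rewrite gK piE.
Qed.

Lemma diag_pres_pair (R : pzRingType) (M N : lmodType R) m n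
    (d : 'rV[R]_m) (e : 'rV[R]_n) :
  diag_pres M d -> diag_pres N e -> diag_pres (M * N)%type (row_mx d e).
Proof.
move=> [p [i [ipK piE]]] [q [j [jqK qjE]]].
have [P PE] : exists P : {linear 'rV[R]_(m + n) -> (M * N)%type},
    P =1 fun v => (p (lsubmx v), q (rsubmx v)).
  by apply: linear_bundle => a u v; rewrite !linearP.
have [I IE] : exists I : {linear (M * N)%type -> 'rV[R]_(m + n)},
    I =1 fun x => row_mx (i x.1) (j x.2).
  apply: linear_bundle => a x y /=.
  by rewrite !linearP /= scale_row_mx add_row_mx.
exists P, I; split=> [[x y]|v]; rewrite IE PE /=.
  by rewrite row_mxKl row_mxKr ipK jqK.
rewrite piE qjE; apply/rowP => k; rewrite -[v in RHS]hsubmxK !mxE.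
by case: splitP => k' _; rewrite !mxE ?row_mxEl ?row_mxEr.
Qed.

(** An endomorphism of the free module of rank 1 is right multiplication by its value at the
    generator; [e] is that value for the projection onto [M]. *)
Lemma diag_pres_rV1 (R : pzRingType) (M K : lmodType R) :
  mod_iso 'rV[R]_1 (M * K)%type -> exists e : 'rV[R]_1, diag_pres M e.
Proof.
move=> /mod_iso_bundle[f [g [fK gK]]].
have [p pE] : exists p : {linear 'rV[R]_1 -> M}, p =1 fun v => (f v).1.
  by apply: linear_bundle => a u v; rewrite linearP.
have [i iE] : exists i : {linear M -> 'rV[R]_1}, i =1 fun x => g (x, 0).
  apply: linear_bundle => a u v; rewrite -linearP; congr (g _).
  by congr pair => /=; rewrite scaler0 addr0.
exists (i (p (const_mx 1))), p, i; split=> [x|v]; first by rewrite iE pE gK.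
have {1}-> : v = v 0 0 *: const_mx 1.
  by apply/rowP => j; rewrite !mxE ord1 mulr1.
by rewrite !linearZ; apply/rowP => j; rewrite ord1 !mxE.
Qed.

(** Induction on [n]: refining [M * K] against [R] plus a free module of rank [n] cuts [M] into a
    summand [Z11] of [R] and a summand [Z12] of the smaller free module. *)
Lemma refinement_diag_pres (R : pzRingType) n (M K : lmodType R) :
  refinement_ring R -> fg_projective M -> fg_projective K ->
  mod_iso (M * K)%type 'rV[R]_n -> exists e : 'rV[R]_n, diag_pres M e.
Proof.
move=> refR; elim: n => [|n IHn] in M K *.
  move=> _ _ /mod_iso_bundle[f [g [fK gK]]].
  have M0 (x : M) : x = 0.
    by rewrite -[x]/(x, 0 : K).1 -[(x, 0)]fK (thinmx0 (f _)) linear0.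
  exists 0, \0%FUN, \0%FUN; split=> [x|v]; first by rewrite (M0 x).
  by apply/rowP => -[].
move=> fgM fgK isoMK.
have := mod_iso_trans isoMK (mod_iso_pair_rV R 1 n).
move=> /(refR _ _ _ _ fgM fgK (fg_projective_rV _ _) (fg_projective_rV _ _)).
move=> [Z11 [Z12 [Z21 [Z22 [[_ fg12 _ fg22] [isoM _ iso1 ison]]]]]].
have [e1 pres1] := diag_pres_rV1 iso1.
have [e2 pres2] := IHn _ _ fg12 fg22 (mod_iso_sym ison).
by exists (row_mx e1 e2); apply: diag_pres_iso isoM (diag_pres_pair pres1 pres2).
Qed.

Lemma fg_projective_diag_pres (R : pzRingType) (M : lmodType R) :
  refinement_ring R -> fg_projective M ->
  exists n (e : 'rV[R]_n), diag_pres M e.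
Proof.
move=> refR fgM; have [n [K [fgK isoMK]]] := fg_projective_complement fgM.
by have [e] := refinement_diag_pres refR fgM fgK isoMK; exists n, e.
Qed.

(** Since [p] retracts [i], the map [i \o p] is idempotent; its square is read off at the all-ones
    row. *)
Lemma diag_pres_idem (R : pzRingType) (M : lmodType R) n (e : 'rV[R]_n) :
  diag_pres M e -> forall j, e 0 j * e 0 j = e 0 j.
Proof.
move=> [p [i [ipK piE]]] j; have := piE (i (p (const_mx 1))).
by rewrite ipK piE => /rowP/(_ j); rewrite !mxE !mul1r => <-.
Qed.

(** * Maximal ideals: primality and existence *)

Section MaximalIdeals.
Variable R : comPzRingType.
Implicit Types (P I : R -> Prop).

Lemma maximal_ideal_prime P : maximal_ideal P ->
  forall x y, ~ P x -> ~ P y -> ~ P (x * y).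
Proof.
move=> [[P0 PD PM] P1 Pmax] x y nPx nPy Pxy.
(* [I] is the ideal generated by [P] and [x]. If it contains 1 then [y] falls into [P]; otherwise
   maximality puts [x] in [P]. *)
pose I z := exists r, P (z - r * x).
have Iideal : is_ideal I.
  split; first by exists 0; rewrite mul0r subr0.
  - move=> z z' [r Pr] [r' Pr']; exists (r + r').
    have -> : z + z' - (r + r') * x = (z - r * x) + (z' - r' * x) by ring.
    exact: PD.
  - move=> c z [r Pr]; exists (c * r).
    by rewrite -mulrA -mulrBr; apply: PM.
have PI z : P z -> I z by exists 0; rewrite mul0r subr0.
have [I1|nI1] := pselect (I 1).
  have [r Pr] := I1; apply: nPy.
  have -> : y = y * (1 - r * x) + r * (x * y) by ring.
  by apply: PD; apply: PM.
apply: nPx; apply: (Pmax _ Iideal PI nI1).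
by exists 1; rewrite mul1r subrr.
Qed.

Lemma exists_maximal_ideal I : is_ideal I -> ~ I 1 ->
  exists2 P, maximal_ideal P & forall x, I x -> P x.
Proof.
move=> idI nI1.
(* [Zorn_bigcup] also ranges over the empty chain, hence the case [J = set0]. *)
pose Q : set (set R) := fun J =>
  J = set0 \/ [/\ is_ideal J, (forall x, I x -> J x) & ~ J 1].
have [|J [QJ Jmax]] := @Zorn_bigcup R Q.
  move=> F FQ Ftot.
  have [[J0 [FJ0 J0n0]]|none] := pselect (exists J, F J /\ J <> set0); last first.
    left; rewrite -subset0 => x [J FJ Jx]; apply: none; exists J; split=> //.
    by move=> J0; rewrite J0 in Jx.
  have good J : F J -> J <> set0 ->
      [/\ is_ideal J, (forall x, I x -> J x) & ~ J 1].
    by move=> /FQ[].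
  have ne (J : set R) x : J x -> J <> set0 by move=> Jx J_0; rewrite J_0 in Jx.
  right; have [[z0 _ _] IJ0 _] := good _ FJ0 J0n0; split.
  - split; first by exists J0.
    + move=> x y [J FJ Jx] [K FK Ky].
      have [JK|KJ] := Ftot _ _ FJ FK.
        have [[_ KD _] _ _] := good _ FK (ne _ _ Ky).
        by exists K => //; apply: KD => //; apply: JK.
      have [[_ JD _] _ _] := good _ FJ (ne _ _ Jx).
      by exists J => //; apply: JD => //; apply: KJ.
    + move=> r x [J FJ Jx]; have [[_ _ JM] _ _] := good _ FJ (ne _ _ Jx).
      by exists J => //; apply: JM.
  - by move=> x /IJ0; exists J0.
  - by move=> [J FJ J1]; have [_ _] := good _ FJ (ne _ _ J1); apply.
have I0 : I 0 by case: idI.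
(* The maximal element is not the empty set, because [I] lies strictly above it. *)
case: QJ => [J0|[idJ IJ nJ1]].
  exfalso; apply: (Jmax I); last by right.
  rewrite J0; split; first exact: sub0set.
  by move=> /(_ _ I0).
exists J => //; split=> // K idK JK nK1 x Kx; apply: contrapT => nJx.
apply: (Jmax K); last by right; split=> // y /IJ /JK.
by split=> // /(_ _ Kx).
Qed.

Lemma prime_prodr P (J : finType) (A : pred J) (c : J -> R) :
  ~ P 1 -> (forall x y, ~ P x -> ~ P y -> ~ P (x * y)) ->
  (forall j, A j -> ~ P (c j)) -> ~ P (\prod_(j | A j) c j).
Proof.
by move=> P1 PM cP; apply: (big_ind (fun x => ~ P x)).
Qed.

End MaximalIdeals.

(** * Fractions, and clearing denominators in local isomorphisms *)

Section Localization.
Variables (R : comPzRingType) (P : R -> Prop).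
Hypotheses (nP1 : ~ P 1) (nPM : forall x y, ~ P x -> ~ P y -> ~ P (x * y)).

Lemma loc_eqP (M : lmodType R) (x y : M * R) :
  loc_eq P x y <-> exists u, ~ P u /\ (u * y.2) *: x.1 = (u * x.2) *: y.1.
Proof.
split=> [] [u [nPu uE]]; exists u; split=> //.
  by move: uE; rewrite scalerBr !scalerA => /eqP; rewrite subr_eq0 => /eqP.
by rewrite scalerBr !scalerA uE subrr.
Qed.

Lemma loc_eq_refl (M : lmodType R) (x : M * R) : loc_eq P x x.
Proof. by apply/loc_eqP; exists 1. Qed.

Lemma loc_eq_sym (M : lmodType R) (x y : M * R) : loc_eq P x y -> loc_eq P y x.
Proof. by move=> /loc_eqP[u [nPu uE]]; apply/loc_eqP; exists u. Qed.

Lemma loc_eq_trans (M : lmodType R) (y x z : M * R) :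
  ~ P y.2 -> loc_eq P x y -> loc_eq P y z -> loc_eq P x z.
Proof.
move=> nPy /loc_eqP[u [nPu uE]] /loc_eqP[v [nPv vE]]; apply/loc_eqP.
(* Eliminating [y] costs its denominator as an extra factor. *)
exists (u * v * y.2); split; first by do !apply: nPM.
have -> : u * v * y.2 * z.2 = (v * z.2) * (u * y.2) by ring.
rewrite -scalerA uE scalerA [v * _ * _]mulrC -[LHS]scalerA vE scalerA.
by congr (_ *: _); ring.
Qed.

Lemma loc_add_compat (M : lmodType R) (x x' y y' : M * R) :
  loc_eq P x x' -> loc_eq P y y' -> loc_eq P (loc_add x y) (loc_add x' y').
Proof.
move=> /loc_eqP[u [nPu uE]] /loc_eqP[v [nPv vE]]; apply/loc_eqP.
exists (u * v); split; first exact: nPM.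
rewrite /= !scalerDr !scalerA; congr (_ + _).
  have -> : u * v * (x'.2 * y'.2) * y.2 = v * y'.2 * y.2 * (u * x'.2) by ring.
  by rewrite -scalerA uE scalerA; congr (_ *: _); ring.
have -> : u * v * (x'.2 * y'.2) * x.2 = u * x'.2 * x.2 * (v * y'.2) by ring.
by rewrite -scalerA vE scalerA; congr (_ *: _); ring.
Qed.

Lemma loc_scale_compat (M : lmodType R) r t (x x' : M * R) :
  loc_eq P x x' -> loc_eq P (loc_scale r t x) (loc_scale r t x').
Proof.
move=> /loc_eqP[u [nPu uE]]; apply/loc_eqP; exists u; split=> //=.
rewrite !scalerA; have -> : u * (t * x'.2) * r = t * r * (u * x'.2) by ring.
by rewrite -scalerA uE scalerA; congr (_ *: _); ring.
Qed.

(** [loc_iso] records linearity for [f] only. It passes to [g] by applying [g] to the linearity of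
    [f] at the fractions [g x], [g y]. *)
Lemma loc_iso_sym (M N : lmodType R) : loc_iso P M N -> loc_iso P N M.
Proof.
move=> [f [g [fP gP fE gE [fD fZ fK gK]]]]; exists g, f; split=> //; split=> //.
- move=> x y nPx nPy; have [nPgx nPgy] := (gP _ nPx, gP _ nPy).
  have nPa : ~ P (loc_add (g x) (g y)).2 by apply: nPM.
  have nPb : ~ P (loc_add x y).2 by apply: nPM.
  apply: loc_eq_trans (fK _ nPa); first by apply/gP/fP.
  apply: gE => //; first exact: fP.
  apply: loc_eq_sym; apply: loc_eq_trans (fD _ _ nPgx nPgy) _.
    by apply: nPM; apply: fP.
  by apply: loc_add_compat; apply: gK.
- move=> r t x nPt nPx; have nPgx := gP _ nPx.
  have nPa : ~ P (loc_scale r t (g x)).2 by apply: nPM.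
  have nPb : ~ P (loc_scale r t x).2 by apply: nPM.
  apply: loc_eq_trans (fK _ nPa); first by apply/gP/fP.
  apply: gE => //; first exact: fP.
  apply: loc_eq_sym; apply: loc_eq_trans (fZ _ _ _ nPt nPgx) _.
    by apply: nPM => //; apply: fP.
  by apply: loc_scale_compat; apply: gK.
Qed.

Lemma rV_sum_delta (M : lmodType R) n (p : {linear 'rV[R]_n -> M}) v :
  p v = \sum_j v 0 j *: p (delta_mx 0 j).
Proof.
by rewrite {1}[v]row_sum_delta linear_sum; apply: eq_bigr => j _; rewrite linearZ.
Qed.

(* Clearing denominators: an [R_P]-linear map [f] on the fractions of a f.g.
   projective module is [F / s] for some [R]-linear [F] and [s] not in [P]. *)
Lemma loc_linear_lift (M N : lmodType R) (f : M * R -> N * R) :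
  fg_projective M ->
  (forall x, ~ P x.2 -> ~ P (f x).2) ->
  (forall x y, ~ P x.2 -> ~ P y.2 ->
     loc_eq P (f (loc_add x y)) (loc_add (f x) (f y))) ->
  (forall r t x, ~ P t -> ~ P x.2 ->
     loc_eq P (f (loc_scale r t x)) (loc_scale r t (f x))) ->
  exists (F : {linear M -> N}) s,
    ~ P s /\ forall x, loc_eq P (f (x, 1)) (F x, s).
Proof.
move=> /fg_projective_bundle[n [p [i ipK]]] fP fD fZ.
have fP1 x : ~ P (f (x, 1)).2 by exact: fP.
have nP11 : ~ P (1 * 1) by rewrite mulr1.
pose x0 k := p (delta_mx 0 k).
(* [s] is a common denominator for the images of the generators [x0 k], and [y0 k] is the numerator
   over [s]. *)
pose s := \prod_k (f (x0 k, 1)).2.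
pose c k := \prod_(l | l != k) (f (x0 l, 1)).2.
pose y0 k := c k *: (f (x0 k, 1)).1.
have nPs : ~ P s by apply: prime_prodr.
have f_gen k : loc_eq P (f (x0 k, 1)) (y0 k, s).
  apply/loc_eqP; exists 1; split=> //=.
  by rewrite /s /y0 /c (bigD1 k) //= scalerA; congr (_ *: _); ring.
have f_scale a x y : loc_eq P (f (x, 1)) (y, s) ->
    loc_eq P (f (a *: x, 1)) (a *: y, s).
  move=> fxy; have /= := fZ a 1 (x, 1) nP1 nP1; rewrite /loc_scale /= mulr1.
  move=> /loc_eq_trans; apply; first by rewrite /= mul1r.
  have -> : s = 1 * s by rewrite mul1r.
  exact: (loc_scale_compat a 1 fxy).
have f_add x x' y y' : loc_eq P (f (x, 1)) (y, s) ->
    loc_eq P (f (x', 1)) (y', s) -> loc_eq P (f (x + x', 1)) (y + y', s).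
  move=> fxy fxy'; have := fD (x, 1) (x', 1) nP1 nP1.
  rewrite {1}/loc_add /= !scale1r mulr1.
  move=> /loc_eq_trans; apply; first exact: nPM.
  apply: loc_eq_trans (loc_add_compat fxy fxy') _; first exact: nPM.
  apply/loc_eqP; exists 1; split=> //=.
  by rewrite -scalerDr scalerA; congr (_ *: _); ring.
have f_zero : loc_eq P (f (0, 1)) (0, s).
  have := fZ 0 1 (0, 1) nP1 nP1; rewrite {1}/loc_scale /= scaler0 mulr1.
  move=> /loc_eq_trans; apply; first by rewrite /= mul1r.
  by apply/loc_eqP; exists 1; split=> //=; rewrite scale0r !scaler0.
(* Defining [F] through the coordinates [i x] makes it well defined whatever the relations among the
   generators. *)
have [F FE] : exists F : {linear M -> N}, F =1 fun x => \sum_k i x 0 k *: y0 k.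
  apply: linear_bundle => a x y; rewrite scaler_sumr -big_split /=.
  by apply: eq_bigr => k _; rewrite linearP !mxE scalerDl scalerA.
exists F, s; split=> // x; rewrite FE -{1}[x]ipK rV_sum_delta.
apply: (big_rec2 (fun y x => loc_eq P (f (x, 1)) (y, s))) => // k y x' _.
by move=> fxy; apply: f_add => //; apply/f_scale/f_gen.
Qed.

(** [F] clears the denominators of [f]. Each generator of [N] has a multiple, by a scalar outside
    [P], in the image of [F]; [G] sends the generators to such preimages, rescaled to a common
    scalar. *)
Lemma loc_iso_retract (M N : lmodType R) :
  fg_projective M -> fg_projective N -> loc_iso P M N ->
  exists (F : {linear M -> N}) (G : {linear N -> M}) s,
    ~ P s /\ forall y, F (G y) = s *: y.
Proof.
move=> fgM /fg_projective_bundle[m [q [j jqK]]].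
move=> [f [g [fP gP fE gE [fD fZ fK gK]]]].
have [F [s [nPs fF]]] := loc_linear_lift fgM fP fD fZ.
(* With [g (y, 1) = (z, t)], the fraction [f (z, 1)] equals both [F z / s] and [t y / 1]. Hence
   [u F z = u s t y] for some [u] outside [P], and [(u z, u t)] is the witness. *)
have lift y : exists wc : M * R, ~ P wc.2 /\ F wc.1 = (s * wc.2) *: y.
  have := gK (y, 1) nP1; have := gP (y, 1) nP1; case: (g _) => z t /= nPt fzt.
  have nP1t : ~ P (1 * t) by rewrite mul1r.
  have eq1 : loc_eq P (z, 1) (loc_scale t 1 (z, t)).
    by apply/loc_eqP; exists 1; split=> //=; rewrite scalerA; congr (_ *: _); ring.
  have eq2 : loc_eq P (f (z, 1)) (t *: y, 1).
    apply: loc_eq_trans (fE (z, 1) (loc_scale t 1 (z, t)) nP1 nP1t eq1) _.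
      exact: fP.
    apply: loc_eq_trans (fZ t 1 (z, t) nP1 nPt) _.
      by apply: nPM => //; apply: fP.
    by have := loc_scale_compat t 1 fzt; rewrite {2}/loc_scale /= mulr1.
  have := loc_eq_trans (fP (z, 1) nP1) (loc_eq_sym (fF z)) eq2.
  move=> /loc_eqP[u [nPu /= uE]]; exists (u *: z, u * t); split=> /=.
    exact: nPM.
  rewrite linearZ /=; move: uE; rewrite mulr1 => ->.
  by rewrite scalerA; congr (_ *: _); ring.
have [wc wcP] := choice (fun k => lift (q (delta_mx 0 k))).
pose c k := \prod_(l | l != k) (wc l).2.
have [G GE] : exists G : {linear N -> M},
    G =1 fun y => \sum_k j y 0 k *: (c k *: (wc k).1).
  apply: linear_bundle => a x y; rewrite scaler_sumr -big_split /=.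
  by apply: eq_bigr => k _; rewrite linearP !mxE scalerDl scalerA.
exists F, G, (s * \prod_k (wc k).2); split.
  by apply: nPM => //; apply: prime_prodr => // k _; have [] := wcP k.
move=> y; rewrite GE -{2}[y]jqK (rV_sum_delta q) linear_sum scaler_sumr.
apply: eq_bigr => k _; have [_ FwE] := wcP k.
rewrite !linearZ /= FwE !scalerA (bigD1 k) //=.
by congr (_ *: _); rewrite /c; ring.
Qed.

End Localization.

(** * The local rank at a maximal ideal *)

(** Pad both factors to square matrices with zeros; the padded [B] has a zero column. *)
Lemma det_mul_thin (R : comPzRingType) k l (B : 'M[R]_(k, l)) (A : 'M[R]_(l, k)) :
  (l < k)%N -> \det (B *m A) = 0.
Proof.
move=> ltlk; have [d kE] : exists d, k = (l + d.+1)%N.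
  by exists (k - l.+1)%N; rewrite addnS -addSn subnKC.
subst k.
have -> : B *m A = row_mx B (0 : 'M_(_, d.+1)) *m col_mx A (0 : 'M_(d.+1, _)).
  by rewrite mul_row_col mul0mx addr0.
rewrite det_mulmx (expand_det_col _ (rshift l ord0)) big1 ?mul0r // => a _.
by rewrite row_mxEr mxE mul0r.
Qed.

Section LocalRank.
Variables (R : comPzRingType) (P : R -> Prop).
Hypothesis Pid : is_ideal P.
Hypotheses (nP1 : ~ P 1) (nPM : forall x y, ~ P x -> ~ P y -> ~ P (x * y)).

Definition rank_set n (e : 'rV[R]_n) : {set 'I_n} :=
  [set j | ~~ `[< P (e 0 j) >]].

Lemma rank_setP n (e : 'rV[R]_n) j : reflect (~ P (e 0 j)) (j \in rank_set e).
Proof. by rewrite inE; apply: (iffP idP) => /asboolPn. Qed.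

Lemma notin_idealB1 x : P x -> ~ P (1 - x).
Proof.
case: Pid => _ PD _ Px P1x; apply: nP1.
by rewrite -[1](subrK x); apply: PD.
Qed.

(* If [d] had more entries outside [P] than [e], the identity of a free module
   of rank [#|rank_set d|] would, up to a scalar not in [P], factor through one
   of smaller rank; such a product of matrices has determinant [0]. *)
Lemma rank_set_le (M N : lmodType R) n m (e : 'rV[R]_n) (d : 'rV[R]_m)
    (F : {linear M -> N}) (G : {linear N -> M}) s :
  diag_pres M e -> diag_pres N d -> ~ P s -> (forall y, F (G y) = s *: y) ->
  (#|rank_set d| <= #|rank_set e|)%N.
Proof.
move=> [p [i [ipK piE]]] [q [j [jqK qjE]]] nPs FG.
rewrite leqNgt; apply/negP => lt_rank.
(* On the image of [i], multiplication by [e 0 k] fixes coordinate [k], so [1 - e 0 k] kills it.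
   Thus [c] kills every coordinate outside [rank_set e]. *)
pose c := \prod_(k in ~: rank_set e) (1 - e 0 k).
have nPc : ~ P c.
  apply: prime_prodr => // k; rewrite inE => /rank_setP/contrapT.
  exact: notin_idealB1.
have ce k (v : 'rV_n) : k \notin rank_set e -> c * i (p v) 0 k = 0.
  move=> kNe; have kC : k \in ~: rank_set e by rewrite inE.
  have : diag_act e (i (p v)) 0 k = i (p v) 0 k by rewrite -piE ipK.
  rewrite mxE /c (bigD1 k) //= => eq_k.
  have : (1 - e 0 k) * i (p v) 0 k = 0.
    by rewrite mulrBl mul1r [e _ _ * _]mulrC eq_k subrr.
  by rewrite mulrAC => ->; rewrite mul0r.
pose x a := G (q (delta_mx 0 a)).
(* [B] and [A] are the matrices of [c] times [G] and of [F], restricted to the coordinates in the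
   two rank sets. *)
pose B := \matrix_(a < #|rank_set d|, b < #|rank_set e|)
  (c * i (x (enum_val a)) 0 (enum_val b)).
pose A := \matrix_(b < #|rank_set e|, a < #|rank_set d|)
  j (F (p (delta_mx 0 (enum_val b)))) 0 (enum_val a).
have BA : B *m A = diag_mx (\row_a (c * s * d 0 (enum_val a))).
  apply/matrixP => a a'; rewrite mxE.
  pose t k := c * i (x (enum_val a)) 0 k *
              j (F (p (delta_mx 0 k))) 0 (enum_val a').
  rewrite (eq_bigr (fun b => t (enum_val b))); last by move=> b _; rewrite !mxE.
  (* By [ce] the terms outside [rank_set e] vanish, so the sum may run over all coordinates and
     [F (G y) = s *: y] applies. *)
  rewrite -(big_enum_val t) /= big_mkcond /= (eq_bigr t); last first.
    move=> k _; case: ifPn => // kNe.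
    by rewrite /t -[x _]ipK ce ?mul0r.
  have -> : \sum_k t k = c * j (F (p (i (x (enum_val a))))) 0 (enum_val a').
    rewrite (rV_sum_delta p) !linear_sum summxE mulr_sumr.
    by apply: eq_bigr => k _; rewrite !linearZ mxE /t mulrA.
  rewrite ipK FG linearZ /= qjE !mxE eqxx /= (inj_eq enum_val_inj) eq_sym.
  by case: eqP => [->|_]; rewrite ?mulr1n ?mulr0n; ring.
have := det_mul_thin B A lt_rank; rewrite BA det_diag => det0.
have : ~ P (\prod_(b < #|rank_set d|) (\row_a (c * s * d 0 (enum_val a))) 0 b).
  apply: prime_prodr => // a _; rewrite mxE.
  by apply: nPM; [exact: nPM | apply/rank_setP/enum_valP].
by apply; rewrite det0; case: Pid.
Qed.

(** Take for [a] the product of whichever of [e 0 k], [1 - e 0 k] is known to lie outside [P]: the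
    factor at [k] absorbs or annihilates [e 0 k]. *)
Lemma rank_separator n (e : 'rV[R]_n) : (forall k, e 0 k * e 0 k = e 0 k) ->
  exists a, [/\ ~ P a, a * a = a &
    forall k, a * e 0 k = a * (k \in rank_set e)%:R].
Proof.
move=> ee; pose h k := if k \in rank_set e then e 0 k else 1 - e 0 k.
have hh k : h k * h k = h k.
  rewrite /h; case: ifP => // _; rewrite mulrBl mul1r mulrBr mulr1 ee.
  by rewrite subrr subr0.
exists (\prod_k h k); split.
- apply: prime_prodr => // k _; rewrite /h; case: rank_setP => // /contrapT.
  exact: notin_idealB1.
- by rewrite -big_split; apply: eq_bigr => k _; exact: hh.
- move=> k; rewrite (bigD1 k) //= mulrAC [RHS]mulrAC; congr (_ * _).
  rewrite /h; case: ifP => _; first by rewrite mulr1 ee.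
  by rewrite mulr0 mulrBl mul1r ee subrr.
Qed.

End LocalRank.

(** * Idempotents over which the two modules become isomorphic *)

Definition set_ind (R : pzRingType) n (T : {set 'I_n}) : 'rV[R]_n :=
  \row_k (k \in T)%:R.

(** The rows of [A] are the unit vectors at the elements of [T]. A separate [l] lets two sets of
    equal cardinality share the intermediate dimension. *)
Lemma set_coisometry (R : comPzRingType) n (T : {set 'I_n}) l : #|T| = l ->
  exists A : 'M[R]_(l, n), A *m A^T = 1%:M /\ A^T *m A = diag_mx (set_ind R T).
Proof.
move=> <-; exists (\matrix_(a, k) (enum_val a == k)%:R); split.
  apply/matrixP => a b; rewrite !mxE (bigD1 (enum_val b)) //= !mxE eqxx mulr1.
  rewrite (inj_eq enum_val_inj) big1 ?addr0 // => k nk.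
  by rewrite !mxE [_ == k in X in _ * X]eq_sym (negPf nk) mulr0.
apply/matrixP => k k'; rewrite !mxE.
pose t l := (l == k)%:R * (l == k')%:R : R.
rewrite (eq_bigr (fun b => t (enum_val b))); last by move=> b _; rewrite !mxE.
rewrite -(big_enum_val t) /= big_mkcond (bigD1 k) //= big1 ?addr0.
  by rewrite /t eqxx mul1r; case: (k \in T); case: eqP.
by move=> l' nl; rewrite /t (negPf nl) mul0r if_same.
Qed.

Lemma diag_act_set (R : comPzRingType) n (a : R) (e : 'rV[R]_n)
    (T : {set 'I_n}) v :
  (forall k, a * e 0 k = a * (k \in T)%:R) ->
  a *: diag_act e v = a *: (v *m diag_mx (set_ind R T)).
Proof.
move=> aeT; rewrite mul_mx_diag; apply/rowP => k.
by rewrite !mxE mulrCA aeT mulrCA.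
Qed.

Section IdempotentIso.
Variables (R : comPzRingType) (M N : lmodType R).

(* [aM] and [aN] are isomorphic, for [a] idempotent. *)
Definition iso_on (a : R) : Prop :=
  a * a = a /\ exists (F : {linear M -> N}) (G : {linear N -> M}),
    (forall x, a *: G (F x) = a *: x) /\ (forall y, a *: F (G y) = a *: y).

Lemma iso_on0 : iso_on 0.
Proof.
split; first by rewrite mulr0.
by exists \0%FUN, \0%FUN; split=> x; rewrite !scale0r.
Qed.

Lemma iso_onM a b : b * b = b -> iso_on a -> iso_on (b * a).
Proof.
move=> bb [aa [F [G [FK GK]]]]; split; first by rewrite mulrACA bb aa.
by exists F, G; split=> x; rewrite -!scalerA ?FK ?GK.
Qed.

Lemma iso_onD a b : a * b = 0 -> iso_on a -> iso_on b -> iso_on (a + b).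
Proof.
move=> ab0 [aa [F [G [FK GK]]]] [bb [F' [G' [FK' GK']]]].
have ba0 : b * a = 0 by rewrite mulrC.
split; first by rewrite mulrDl !mulrDr aa bb ab0 ba0 addr0 add0r.
(* Glue the maps over [a] and over [b]; orthogonality kills the cross terms of a composite. *)
pose H (U V : lmodType R) (f f' : {linear U -> V}) x := a *: f x + b *: f' x.
have Hlin (U V : lmodType R) f f' : exists h : {linear U -> V}, h =1 H U V f f'.
  apply: linear_bundle => c x y; rewrite /H (linearP f) (linearP f').
  by rewrite !scalerDr !scalerA addrACA (mulrC c a) (mulrC c b).
have HH (U V : lmodType R) (f f' : {linear U -> V}) (g g' : {linear V -> U}) x :
    (forall x, a *: g (f x) = a *: x) -> (forall x, b *: g' (f' x) = b *: x) ->
    (a + b) *: H _ _ g g' (H _ _ f f' x) = (a + b) *: x.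
  move=> fK fK'; rewrite /H (linearD g) (linearD g') !(linearZ_LR g).
  rewrite !(linearZ_LR g') scalerDr !scalerA !mulrDl aa bb ab0 ba0 addr0 add0r.
  rewrite !scalerDr !scalerA aa bb ab0 ba0 !scale0r addr0 add0r fK fK'.
  by rewrite -scalerDl.
have [h hE] := Hlin _ _ F F'; have [k kE] := Hlin _ _ G G'.
by exists h, k; split=> x; rewrite hE kE ?hE ?kE HH.
Qed.

Lemma iso_on1 : iso_on 1 -> mod_iso M N.
Proof.
move=> [_ [F [G [FK GK]]]]; exists F; split; first exact: linearP.
exists G => x; first by rewrite -[LHS]scale1r FK scale1r.
by rewrite -[LHS]scale1r GK scale1r.
Qed.

(** This is the union of the ideals [aR] with [iso_on a]; it contains 1 only through [a = 1]. *)
Lemma iso_on_ideal : is_ideal (fun r => exists2 a, iso_on a & r * a = r).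
Proof.
split; first by exists 0; [exact: iso_on0 | rewrite mulr0].
- move=> r r' [a isoa ra] [b isob r'b]; have [aa bb] := (isoa.1, isob.1).
  have a1a : a * (1 - a) = 0 by rewrite mulrBr mulr1 aa subrr.
  (* An orthogonal sum that generates [aR + bR]. *)
  exists (a + (1 - a) * b).
    apply: iso_onD => //; first by rewrite mulrA a1a mul0r.
    by apply: iso_onM => //; rewrite mulrBl mul1r a1a subr0.
  have -> : (r + r') * (a + (1 - a) * b) =
      r * a + (r - r * a) * b + r' * b + (r' - r' * b) * a by ring.
  by rewrite ra r'b !subrr !mul0r !addr0.
- by move=> c r [a isoa ra]; exists a => //; rewrite -mulrA ra.
Qed.

(** Over [a], the modules become the coordinate submodules of [T] and [S], and the partial
    permutation matrices [A^T *m B] and [B^T *m A] exchange these. *)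
Lemma iso_on_equal_rank n m (e : 'rV[R]_n) (d : 'rV[R]_m)
    (T : {set 'I_n}) (S : {set 'I_m}) a :
  diag_pres M e -> diag_pres N d -> #|T| = #|S| -> a * a = a ->
  (forall k, a * e 0 k = a * (k \in T)%:R) ->
  (forall k, a * d 0 k = a * (k \in S)%:R) -> iso_on a.
Proof.
move=> [p [i [ipK piE]]] [q [j [jqK qjE]]] TS aa aeT adS; split=> //.
have [A [AA1 AAT]] := set_coisometry R TS.
have [B [BB1 BBS]] := set_coisometry R (erefl #|S|).
have [F FE] : exists F : {linear M -> N}, F =1 fun x => q (i x *m (A^T *m B)).
  by apply: linear_bundle => c x y; rewrite linearP mulmxDl -scalemxAl linearP.
have [G GE] : exists G : {linear N -> M}, G =1 fun y => p (j y *m (B^T *m A)).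
  by apply: linear_bundle => c x y; rewrite linearP mulmxDl -scalemxAl linearP.
exists F, G; split=> x; rewrite FE GE.
  rewrite qjE -linearZ /= scalemxAl (diag_act_set _ adS) -scalemxAl.
  have -> : i x *m (A^T *m B) *m diag_mx (set_ind R S) *m (B^T *m A) =
      i x *m diag_mx (set_ind R T).
    rewrite -BBS -AAT -!mulmxA; do 2 congr (_ *m _).
    by rewrite !mulmxA BB1 mul1mx BB1 mul1mx.
  by rewrite -(diag_act_set _ aeT) -piE ipK linearZ /= ipK.
rewrite piE -linearZ /= scalemxAl (diag_act_set _ aeT) -scalemxAl.
have -> : j x *m (B^T *m A) *m diag_mx (set_ind R T) *m (A^T *m B) =
    j x *m diag_mx (set_ind R S).
  rewrite -BBS -AAT -!mulmxA; do 2 congr (_ *m _).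
  by rewrite !mulmxA AA1 mul1mx AA1 mul1mx.
by rewrite -(diag_act_set _ adS) -qjE jqK linearZ /= jqK.
Qed.

End IdempotentIso.

(** * From local to global isomorphism *)

Lemma iso_on_local (R : comPzRingType) (M N : lmodType R) (P : R -> Prop)
    n m (e : 'rV[R]_n) (d : 'rV[R]_m) :
  maximal_ideal P -> fg_projective M -> fg_projective N ->
  diag_pres M e -> diag_pres N d -> loc_iso P M N ->
  exists2 a, ~ P a & iso_on M N a.
Proof.
move=> Pmax fgM fgN presM presN isoP.
have nPM := maximal_ideal_prime Pmax; have [Pid nP1 _] := Pmax.
have eq_rank : #|rank_set P e| = #|rank_set P d|.
  apply/eqP; rewrite eqn_leq; apply/andP; split.
    have [F [G [s [nPs FG]]]] :=
      loc_iso_retract nP1 nPM fgN fgM (loc_iso_sym nPM isoP).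
    exact: rank_set_le FG.
  have [F [G [s [nPs FG]]]] := loc_iso_retract nP1 nPM fgM fgN isoP.
  exact: rank_set_le FG.
have [a [nPa aa aE]] := rank_separator Pid nP1 nPM (diag_pres_idem presM).
have [b [nPb bb bE]] := rank_separator Pid nP1 nPM (diag_pres_idem presN).
(* [a] makes the diagonal of [M] constant, [b] that of [N]; the product does both. *)
exists (a * b); first exact: nPM.
apply: (iso_on_equal_rank presM presN eq_rank).
- by rewrite mulrACA aa bb.
- by move=> k; rewrite mulrAC aE mulrAC.
- by move=> k; rewrite -mulrA bE mulrA.
Qed.

Lemma mod_iso_loc_iso (R : comPzRingType) (P : R -> Prop) (M N : lmodType R) :
  ~ P 1 -> mod_iso M N -> loc_iso P M N.
Proof.
move=> nP1 /mod_iso_bundle[f [g [fK gK]]].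
exists (fun x => (f x.1, x.2)), (fun y => (g y.1, y.2)).
split=> //.
- move=> x y _ _ [u [nPu uE]]; exists u; split=> //=.
  by rewrite -!linearZ -linearB -linearZ uE linear0.
- move=> x y _ _ [u [nPu uE]]; exists u; split=> //=.
  by rewrite -!linearZ -linearB -linearZ uE linear0.
split=> [x y _ _|r t x _ _|[x s] _|[y s] _] /=.
- by rewrite /loc_add /= linearD !linearZ; exact: loc_eq_refl.
- by rewrite /loc_scale /= linearZ; exact: loc_eq_refl.
- by rewrite fK; exact: loc_eq_refl.
- by rewrite gK; exact: loc_eq_refl.
Qed.

Theorem theorem2p5 (R : comPzRingType) (M N : lmodType R) :
  refinement_ring R -> fg_projective M -> fg_projective N ->
  (mod_iso M N <->
   forall P : R -> Prop, maximal_ideal P -> loc_iso P M N).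
Proof.
move=> refR fgM fgN; split.
  by move=> isoMN P [_ nP1 _]; apply: mod_iso_loc_iso.
move=> isoP.
have [n [e presM]] := fg_projective_diag_pres refR fgM.
have [m [d presN]] := fg_projective_diag_pres refR fgN.
apply: iso_on1; apply: contrapT => niso1.
(* If 1 is not in [iso_on], the ideal is proper and lies in some maximal [P], yet [iso_on_local]
   gives it an element outside [P]. *)
have [[a isoa]|P Pmax PI] := exists_maximal_ideal (iso_on_ideal M N).
  by rewrite mul1r => a1; apply: niso1; rewrite -a1.
have [a nPa isoa] := iso_on_local Pmax fgM fgN presM presN (isoP P Pmax).
by apply: nPa; apply: PI; exists a => //; case: isoa.
Qed.
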